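(* Let $\mathcal{C}=\{c_0,c_1,\dots,c_n\}$. Let $S=R_{\Gamma\Gamma}(\cdot\,;z_i,z_j)$, $T=R_{\Delta\Gamma}(\cdot\,;z_i,z_j)$, $S'=R_{\Delta\Delta}(\cdot\,;z_j,z_i)$ and $T'=R_{\Delta\Gamma}(\cdot\,;z_j,z_i)$ be the colored stochastic R-vertex weights with the indicated types and (ordered) spectral parameters, and let $K$ be the color-preserving cap weight: $K(x,y)=1$ if $x=y\in\mathcal{C}$ and $K(x,y)=0$ otherwise. For $\epsilon_1,\epsilon_2,\epsilon_3,\epsilon_4\in\mathcal{C}$ put $$Z(I_5(\epsilon_1,\epsilon_2,\epsilon_3,\epsilon_4))=\sum_{s,\delta_1,\delta_2,\delta_3\in\mathcal{C}} S(\epsilon_2,\epsilon_1,\delta_1,s)\,T(\epsilon_3,s,\delta_2,\delta_3)\,K(\delta_1,\delta_2)\,K(\delta_3,\epsilon_4),$$ $$Z(I_6(\epsilon_1,\epsilon_2,\epsilon_3,\epsilon_4))=\sum_{s,\delta_2,\delta_3,\delta_4\in\mathcal{C}} S'(\epsilon_4,\epsilon_3,s,\delta_4)\,T'(s,\epsilon_2,\delta_2,\delta_3)\,K(\epsilon_1,\delta_2)\,K(\delta_3,\delta_4).$$ Then for all $\epsilon_1,\epsilon_2,\epsilon_3,\epsilon_4\in\mathcal{C}$, $$Z(I_5(\epsilon_1,\epsilon_2,\epsilon_3,\epsilon_4))=Z(I_6(\epsilon_1,\epsilon_2,\epsilon_3,\epsilon_4)).$$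
   Context: Parameters: $n\ge1$ is an integer; $q,z_i,z_j$ are indeterminates (equivalently, generic complex numbers for which every denominator is nonzero). For a spectral parameter $z$ write $z'=q+1-\frac1z$. Color labels are ordered by $0<1<\dots<n$; $c_0$ is also written $+$. R-vertices with ordered spectral parameters $(x,y)$: the weight $R_{XY}(\,\cdot\,;x,y)$ is a function of the colors (bottom-left, top-left, top-right, bottom-right). Configurations not listed have weight $0$. For every color $e$, $(e,e,e,e)\mapsto 1$, and for all labels $\alpha<\beta$: - $R_{\Gamma\Gamma}$, with $P=1-(q+1)y+qxy$: $(c_\alpha,c_\beta,c_\alpha,c_\beta)\mapsto\frac{x-y}{P}$, $(c_\beta,c_\alpha,c_\beta,c_\alpha)\mapsto\frac{q(x-y)}{P}$, $(c_\beta,c_\alpha,c_\alpha,c_\beta)\mapsto\frac{(1-qx)(1-y)}{P}$, $(c_\alpha,c_\beta,c_\beta,c_\alpha)\mapsto\frac{(1-x)(1-qy)}{P}$. - $R_{\Delta\Gamma}$: $(c_\alpha,c_\beta,c_\alpha,c_\beta)\mapsto\frac{x'+qy-(q+1)x'y}{1-x'y}$, $(c_\beta,c_\alpha,c_\beta,c_\alpha)\mapsto\frac{q^{-1}x'+y-(1+q^{-1})x'y}{1-x'y}$, $(c_\beta,c_\beta,c_\alpha,c_\alpha)\mapsto\frac{(1-x')(1-qy)}{1-x'y}$, $(c_\alpha,c_\alpha,c_\beta,c_\beta)\mapsto\frac{(1-q^{-1}x')(1-y)}{1-x'y}$. - $R_{\Delta\Delta}$, with $Q=q-(q+1)x'+x'y'$: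 $(c_\alpha,c_\beta,c_\alpha,c_\beta)\mapsto\frac{y'-x'}{Q}$, $(c_\beta,c_\alpha,c_\beta,c_\alpha)\mapsto\frac{q(y'-x')}{Q}$, $(c_\beta,c_\alpha,c_\alpha,c_\beta)\mapsto\frac{(1-x')(q-y')}{Q}$, $(c_\alpha,c_\beta,c_\beta,c_\alpha)\mapsto\frac{(1-y')(q-x')}{Q}$. In $K(x,y)$, $x$ is the top color and $y$ the bottom color of the cap. *)

(* Defs.v *)
From mathcomp Require Import all_boot all_order all_algebra.

Set Implicit Arguments.
Unset Strict Implicit.
Unset Printing Implicit Defensive.

Import GRing.Theory.
Local Open Scope ring_scope.

(* The color [c_i] is its label [i]; comparing labels is comparing naturals. *)
Definition color (n : nat) : finType := 'I_n.+1.

Definition dual_param (F : fieldType) (q z : F) : F := q + 1 - z^-1.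

Definition den_GammaGamma (F : fieldType) (q x y : F) : F :=
  1 - (q + 1) * y + q * x * y.

Definition den_DeltaGamma (F : fieldType) (q x y : F) : F :=
  1 - dual_param q x * y.

Definition den_DeltaDelta (F : fieldType) (q x y : F) : F :=
  q - (q + 1) * dual_param q x + dual_param q x * dual_param q y.

(* In the three weights below, [a b c d] are the colors of the bottom-left,
   top-left, top-right and bottom-right edges; the vertex has the ordered
   spectral parameters [x, y].  Once the case of four equal colors is
   discarded, equating two pairs of edges leaves two distinct colors, whose
   order selects the weight. *)

Definition R_GammaGamma (F : fieldType) (n : nat) (q x y : F)
    (a b c d : color n) : F :=
  let P := den_GammaGamma q x y in
  if [&& a == b, b == c & c == d] then 1
  else if (a == c) && (b == d) then
    if (a < b)%N then (x - y) / P else q * (x - y) / P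
  else if (a == d) && (b == c) then
    if (b < a)%N then (1 - q * x) * (1 - y) / P
    else (1 - x) * (1 - q * y) / P
  else 0.

Definition R_DeltaGamma (F : fieldType) (n : nat) (q x y : F)
    (a b c d : color n) : F :=
  let x' := dual_param q x in
  let D := den_DeltaGamma q x y in
  if [&& a == b, b == c & c == d] then 1
  else if (a == c) && (b == d) then
    if (a < b)%N then (x' + q * y - (q + 1) * x' * y) / D
    else (q^-1 * x' + y - (1 + q^-1) * x' * y) / D
  else if (a == b) && (c == d) then
    if (c < a)%N then (1 - x') * (1 - q * y) / D
    else (1 - q^-1 * x') * (1 - y) / D
  else 0.

Definition R_DeltaDelta (F : fieldType) (n : nat) (q x y : F)
    (a b c d : color n) : F :=
  let x' := dual_param q x in
  let y' := dual_param q y in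
  let Q := den_DeltaDelta q x y in
  if [&& a == b, b == c & c == d] then 1
  else if (a == c) && (b == d) then
    if (a < b)%N then (y' - x') / Q else q * (y' - x') / Q
  else if (a == d) && (b == c) then
    if (b < a)%N then (1 - x') * (q - y') / Q
    else (1 - y') * (q - x') / Q
  else 0.

(* [x] is the color of the top edge of the cap, [y] that of the bottom edge. *)
Definition cap (F : fieldType) (n : nat) (x y : color n) : F :=
  if x == y then 1 else 0.

Definition Z_I5 (F : fieldType) (n : nat) (q zi zj : F)
    (e1 e2 e3 e4 : color n) : F :=
  \sum_(s : color n) \sum_(d1 : color n) \sum_(d2 : color n)
    \sum_(d3 : color n)
      R_GammaGamma q zi zj e2 e1 d1 s * R_DeltaGamma q zi zj e3 s d2 d3
      * cap F d1 d2 * cap F d3 e4.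

Definition Z_I6 (F : fieldType) (n : nat) (q zi zj : F)
    (e1 e2 e3 e4 : color n) : F :=
  \sum_(s : color n) \sum_(d2 : color n) \sum_(d3 : color n)
    \sum_(d4 : color n)
      R_DeltaDelta q zj zi e4 e3 s d4 * R_DeltaGamma q zj zi s e2 d2 d3
      * cap F e1 d2 * cap F d3 d4.

(* Main.v *)
Require Import Defs.
From mathcomp Require Import all_boot all_order all_algebra.
From mathcomp Require Import ring.
Import GRing.Theory.

Local Open Scope ring_scope.

(** The caps identify edges, so both partition functions are sums over the two
    outer edges of the Gamma-Gamma (resp. Delta-Delta) vertex, which must carry
    the two colors entering it.  At most two states survive on each side, and
    color conservation at the Delta-Gamma vertex forces
    [{e1, e2} = {e3, e4}]; what remains is a rational identity for each relative
    order of the two colors, in which [Q(zj, zi) = P(zi, zj) / (zi zj)]. *)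

(** The factor [*+ (a != b)] keeps the single state from being counted twice when [a = b]. *)
Lemma sum_swap_support {V : nmodType} {T : finType} {g : T -> T -> V} (a b : T) :
    (forall c d, (c, d) != (a, b) -> (c, d) != (b, a) -> g c d = 0) ->
  \sum_c \sum_d g c d = g a b + g b a *+ (a != b).
Proof.
move=> g0; rewrite pair_bigA /= (bigD1 (a, b)) //=; congr (_ + _).
have [ab|neq_ab] := eqVneq a b.
  by rewrite mulr0n big1 // => -[c d] /= cd_ab; apply: g0; move: cd_ab; rewrite ab.
rewrite mulr1n (bigD1 (b, a)) /=; last by rewrite xpair_eqE negb_and eq_sym neq_ab.
by rewrite big1 ?addr0 // => -[c d] /andP[cd_ab cd_ba]; apply: g0.
Qed.

Section Weights.

Context {F : fieldType} {n : nat}.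
Implicit Types (q x y : F) (a b c d e : color n).

Lemma sum_capl (f : color n -> F) e : \sum_d f d * cap F e d = f e.
Proof.
rewrite (bigD1 e) //= /cap eqxx mulr1 big1 ?addr0 // => d.
by rewrite eq_sym => /negPf->; rewrite mulr0.
Qed.

Lemma sum_capr (f : color n -> F) e : \sum_d f d * cap F d e = f e.
Proof.
by rewrite -[RHS]sum_capl; apply: eq_bigr => d _; rewrite /cap eq_sym.
Qed.

Lemma R_GammaGamma_eq0 q x y a b c d :
  (c, d) != (a, b) -> (c, d) != (b, a) -> R_GammaGamma q x y a b c d = 0.
Proof.
rewrite /R_GammaGamma !xpair_eqE ![_ == a]eq_sym ![_ == b]eq_sym.
move=> /negPf-> cd_ba; rewrite andbC in cd_ba; rewrite (negPf cd_ba).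
case: ifP => // /and3P[/eqP ab /eqP bc /eqP cd].
by subst; rewrite eqxx in cd_ba.
Qed.

Lemma R_DeltaDelta_eq0 q x y a b c d :
  (c, d) != (a, b) -> (c, d) != (b, a) -> R_DeltaDelta q x y a b c d = 0.
Proof.
rewrite /R_DeltaDelta !xpair_eqE ![_ == a]eq_sym ![_ == b]eq_sym.
move=> /negPf-> cd_ba; rewrite andbC in cd_ba; rewrite (negPf cd_ba).
case: ifP => // /and3P[/eqP ab /eqP bc /eqP cd].
by subst; rewrite eqxx in cd_ba.
Qed.

(** In the first term both colors cross the Gamma-Gamma vertex to the opposite edges; in the second
    each stays on its level, top or bottom. *)
Lemma Z_I5E q x y e1 e2 e3 e4 :
  Z_I5 q x y e1 e2 e3 e4 =
    R_GammaGamma q x y e2 e1 e2 e1 * R_DeltaGamma q x y e3 e1 e2 e4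
    + (R_GammaGamma q x y e2 e1 e1 e2 * R_DeltaGamma q x y e3 e2 e1 e4)
      *+ (e2 != e1).
Proof.
rewrite -(@sum_swap_support _ _
  (fun d s => R_GammaGamma q x y e2 e1 d s * R_DeltaGamma q x y e3 s d e4)).
  rewrite exchange_big; apply: eq_bigr => s _; apply: eq_bigr => d _.
  under eq_bigr do rewrite sum_capr.
  by rewrite sum_capl.
by move=> d s *; rewrite R_GammaGamma_eq0 ?mul0r.
Qed.

Lemma Z_I6E q x y e1 e2 e3 e4 :
  Z_I6 q x y e1 e2 e3 e4 =
    R_DeltaDelta q y x e4 e3 e4 e3 * R_DeltaGamma q y x e4 e2 e1 e3
    + (R_DeltaDelta q y x e4 e3 e3 e4 * R_DeltaGamma q y x e3 e2 e1 e4)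
      *+ (e4 != e3).
Proof.
rewrite -(@sum_swap_support _ _
  (fun s d => R_DeltaDelta q y x e4 e3 s d * R_DeltaGamma q y x s e2 e1 d)).
  apply: eq_bigr => s _; rewrite exchange_big; apply: eq_bigr => d _.
  under eq_bigr do rewrite sum_capl.
  by rewrite sum_capl.
by move=> s d *; rewrite R_DeltaDelta_eq0 ?mul0r.
Qed.

(** Four equal colors fit both excluded patterns, so the branch of weight 1 is ruled out too. *)
Lemma R_DeltaGamma_eq0 q x y a b c d :
  ~~ ((a == c) && (b == d)) -> ~~ ((a == b) && (c == d)) ->
  R_DeltaGamma q x y a b c d = 0.
Proof.
rewrite /R_DeltaGamma => /negPf-> /negPf ab_cd; rewrite ab_cd.
by case: ifP => // /and3P[ab _ cd]; rewrite ab cd in ab_cd.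
Qed.

End Weights.

Theorem theorem4p2 (F : fieldType) (n : nat) (hn : (1 <= n)%N)
    (q zi zj : F)
    (hq : q != 0) (hzi : zi != 0) (hzj : zj != 0)
    (hS : den_GammaGamma q zi zj != 0)
    (hT : den_DeltaGamma q zi zj != 0)
    (hS' : den_DeltaDelta q zj zi != 0)
    (hT' : den_DeltaGamma q zj zi != 0)
    (e1 e2 e3 e4 : color n) :
  Z_I5 q zi zj e1 e2 e3 e4 = Z_I6 q zi zj e1 e2 e3 e4.
Proof.
have QE : den_DeltaDelta q zj zi = den_GammaGamma q zi zj / (zi * zj).
  by rewrite /den_DeltaDelta /den_GammaGamma /dual_param; field; rewrite hzi hzj.
(* The two Delta-Gamma denominators share one numerator, symmetric in [zi] and [zj]; [hN] records
   that it is nonzero. *)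
have TE : den_DeltaGamma q zi zj = (zi - (q + 1) * zi * zj + zj) / zi.
  by rewrite /den_DeltaGamma /dual_param; field; rewrite hzi.
have T'E : den_DeltaGamma q zj zi = (zi - (q + 1) * zi * zj + zj) / zj.
  by rewrite /den_DeltaGamma /dual_param; field; rewrite hzj.
have hN : zi - (q + 1) * zi * zj + zj != 0.
  by move: hT; rewrite TE mulf_eq0 negb_or => /andP[].
rewrite Z_I5E Z_I6E.
(* These alternatives are the two admissible patterns of each of the four Delta-Gamma weights; if
   both fail, both sides are 0. *)
have [paired|] := boolP ((e3 == e1) && (e2 == e4) || (e3 == e2) && (e1 == e4));
  last first.
  rewrite negb_or => /andP[not_crossed not_parallel].
  rewrite !R_DeltaGamma_eq0 ?mulr0 ?mul0rn //.
    by rewrite andbC eq_sym [e4 == e1]eq_sym.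
  by rewrite andbC eq_sym [e4 == e2]eq_sym.
(* If [e2 = e1], all four colors agree and both sides equal 1. *)
have [e21|ne21] := eqVneq e2 e1.
  case/orP: paired => /andP[/eqP-> /eqP<-];
  by rewrite e21 /R_GammaGamma /R_DeltaDelta /R_DeltaGamma !eqxx.
case/orP: paired => /andP[/eqP-> /eqP<-];
  rewrite ?[e1 == e2]eq_sym ne21 mulr1n;
  rewrite /R_GammaGamma /R_DeltaDelta /R_DeltaGamma !eqxx ![e1 == e2]eq_sym;
  rewrite (negPf ne21) /= QE TE T'E /dual_param;
  rewrite /den_GammaGamma in hS *;
  (* Two patterns and two strict orders leave four rational identities, whose denominators are
     products of the factors shown nonzero above. *)
  case: ltngtP ne21 => [_ _|_ _|/val_inj->]; rewrite ?eqxx //; field;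
  by rewrite hS hN hq hzi hzj.
Qed.
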